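(* Let $(A,\le,\odot,\rightarrow,0,1)$ be a bounded MLUB-complete residuated poset and let $B,C,D,E\in\mathcal P_+(A)$. Then: (1) $B\boxdot\{1\}=\operatorname{Max}LU(B)$ and $\{1\}\Rightarrow B=\operatorname{Min}U(B)$; (2) $B\boxdot C=C\boxdot B$; (3) if $B\le U(C)$ and $D\le U(E)$ then $B\boxdot D\le U(C\boxdot E)$; (4) $B\boxdot C\le U(D)$ if and only if $B\le C\Rightarrow D$; (5) $L(C\Rightarrow D)\boxdot C\le U(D)$ and $C\le L(C\Rightarrow D)\Rightarrow D$.
   Context: A residuated poset $(A,\le,\odot,\rightarrow,0,1)$ is a bounded poset with binary operations $\odot,\rightarrow:A\times A\to A$ such that for all $x,y,z,v\in A$: $x\odot1=x$; $x\odot y=y\odot x$; $x\odot(y\odot z)=(x\odot y)\odot z$; if $x\le v$ and $y\le z$ then $x\odot y\le v\odot z$; $x\odot y\le z$ iff $x\le y\rightarrow z$. For $X\subseteq A$: $L(X)$, $U(X)$ are the sets of lower/upper bounds, $\operatorname{Max}X,\operatorname{Min}X$ the maximal/minimal elements. MLUB-complete: for every nonempty $M\subseteq A$, every upper bound of $M$ lies above a minimal upper bound and every lower bound lies below a maximal lower bound. $\mathcal P_+(A)$ = nonempty subsets of $A$; for subsets $X,Y$, $X\le Y$ iff $x\le y$ for all $x\in X,y\in Y$. For $B,C\in\mathcal P_+(A)$: $B\boxdot C=\operatorname{Max}LU(\{b\odot c\mid b\in B,c\in C\})$ and $B\Rightarrow C=\operatorname{Min}U\big(\bigcap\{L(b\rightarrow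 d)\mid b\in B,\ d\in U(C)\}\big)$. *)

(* Defs.v *)
From HB Require Import structures.
From mathcomp Require Import all_boot all_order.
From mathcomp Require Import boolp classical_sets.

Set Implicit Arguments.
Unset Strict Implicit.
Unset Printing Implicit Defensive.

Local Open Scope order_scope.
Local Open Scope classical_set_scope.

Declare Scope residuated_scope.
Delimit Scope residuated_scope with RP.
Local Open Scope residuated_scope.

Reserved Notation "x \odot y" (at level 40, left associativity).
Reserved Notation "x \imp y" (at level 55, right associativity).
Reserved Notation "B \boxdot C" (at level 40, left associativity).
Reserved Notation "B \Imp C" (at level 55, right associativity).
Reserved Notation "X \leS Y" (at level 70, no associativity).

(* The constants 0 and 1 of a residuated poset are \bot and \top. *)
HB.mixin Record isResiduated (d : Order.disp_t) A of Order.TBPOrder d A := {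
  rmul : A -> A -> A;
  rimp : A -> A -> A;
  rmul1 : forall x : A, rmul x \top = x;
  rmulC : forall x y : A, rmul x y = rmul y x;
  rmulA : forall x y z : A, rmul x (rmul y z) = rmul (rmul x y) z;
  rmul_le : forall x y z v : A, x <= v -> y <= z -> rmul x y <= rmul v z;
  radj : forall x y z : A, rmul x y <= z <-> x <= rimp y z }.

#[short(type="residuatedPOrderType")]
HB.structure Definition ResiduatedPOrder (d : Order.disp_t) :=
  { A of Order.TBPOrder d A & isResiduated d A }.

Notation "x \odot y" := (rmul x y) : residuated_scope.
Notation "x \imp y" := (rimp x y) : residuated_scope.

Section PosetNotions.
Context (d : Order.disp_t) (A : porderType d).
Implicit Types X Y : set A.

Definition Max X : set A := [set x | X x /\ forall y, X y -> x <= y -> y = x].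
Definition Min X : set A := [set x | X x /\ forall y, X y -> y <= x -> y = x].

Definition set_le X Y : Prop := forall x y, X x -> Y y -> x <= y.

Definition MLUB_complete : Prop := forall M : set A, M !=set0 ->
  (forall u, ubound M u -> exists2 m, Min (ubound M) m & m <= u) /\
  (forall l, lbound M l -> exists2 m, Max (lbound M) m & l <= m).

End PosetNotions.

Arguments MLUB_complete {d} A.
Notation "X \leS Y" := (set_le X Y) : residuated_scope.

Section ResiduatedSets.
Context (d : Order.disp_t) (A : residuatedPOrderType d).
Implicit Types B C : set A.

Definition boxdot B C : set A :=
  Max (lbound (ubound [set b \odot c | b in B & c in C])).

Definition Imp B C : set A :=
  Min (ubound (\bigcap_(p in B `*` ubound C) lbound [set p.1 \imp p.2])).

End ResiduatedSets.

Notation "B \boxdot C" := (boxdot B C) : residuated_scope.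
Notation "B \Imp C" := (Imp B C) : residuated_scope.

(* Main.v *)
(** MLUB-completeness gives [U(Max(LU(P))) = U(P)] and [L(Min(U(L(W)))) = L(W)].
    Hence upper bounds of [B \boxdot C] are upper bounds of the products
    [b \odot c], and lower bounds of [B \Imp C] are lower bounds of the
    implications [b \imp d] with [d] in [U(C)].  Both order claims then reduce
    to elementwise residuation. *)
Require Import Defs.
From HB Require Import structures.
From mathcomp Require Import all_boot all_order.
From mathcomp Require Import boolp classical_sets.

Import Order.TTheory.

Local Open Scope order_scope.
Local Open Scope classical_set_scope.
Local Open Scope residuated_scope.

Section Bounds.
Context (d : Order.disp_t) (A : porderType d).
Implicit Types X Y : set A.

Lemma set_leEubound X Y : X \leS Y <-> Y `<=` ubound X.
Proof.
by split=> [le_XY y Yy x Xx | sYX x y Xx /sYX]; [exact: le_XY | exact].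
Qed.

Lemma set_leElbound X Y : X \leS Y <-> X `<=` lbound Y.
Proof.
by split=> [le_XY x Xx y Yy | sXY x y /sXY Xx]; [exact: le_XY | exact: Xx].
Qed.

Lemma ubound_lbound_ubound X : ubound (lbound (ubound X)) = ubound X.
Proof.
apply/seteqP; split=> u Uu x Xx; last exact: Xx.
by apply: Uu => v; apply.
Qed.

End Bounds.

Section MLUBComplete.
Context (d : Order.disp_t) (A : tbPOrderType d) (hA : MLUB_complete A).
Implicit Types X W : set A.

(** Each [x] in [X] belongs to LU(X). As U(X) contains [\top], completeness puts [x] below a maximal
    element of LU(X), which [u] bounds. *)
Lemma ubound_Max_lbound_ubound X :
  ubound (Max (lbound (ubound X))) = ubound X.
Proof.
apply/seteqP; split=> u Uu x Xx; last by case: Xx => Lx _; apply: Lx.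
have UX0 : ubound X !=set0 by exists \top => y _; exact: lex1.
have [|m Mm le_xm] := (hA _ UX0).2 x; first by move=> v; apply.
exact: le_trans le_xm (Uu _ Mm).
Qed.

(** Dual argument, with [\bot] as the element of L(W). *)
Lemma lbound_Min_ubound_lbound W : lbound (Min (ubound (lbound W))) = lbound W.
Proof.
apply/seteqP; split=> l Ll w Ww; last by case: Ww => Uw _; apply: Uw.
have LW0 : lbound W !=set0 by exists \bot => y _; exact: le0x.
have [|m Mm le_mw] := (hA _ LW0).1 w; first by move=> v; apply.
exact: le_trans (Ll _ Mm) le_mw.
Qed.

End MLUBComplete.

Section ResiduatedSetsTheory.
Context (d : Order.disp_t) (A : residuatedPOrderType d).
Implicit Types B C D E : set A.

Lemma top_imp (x : A) : \top \imp x = x.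
Proof.
apply/le_anti/andP; split; last by apply/radj; rewrite rmul1.
by rewrite -[leLHS]rmul1; apply/radj.
Qed.

Lemma ubound_products B C (u : A) :
  ubound [set b \odot c | b in B & c in C] u <->
  forall b c, B b -> C c -> b \odot c <= u.
Proof.
split=> [Uu b c Bb Cc | Uu _ [b Bb [c Cc <-]]]; last exact: Uu.
by apply: Uu; exists b => //; exists c.
Qed.

(** An intersection of principal lower cones is the lower cone of the set of their vertices; this
    form fits [lbound_Min_ubound_lbound]. *)
Lemma Imp_lbound B C :
  B \Imp C =
  Min (ubound (lbound [set b \imp x | b in B & x in ubound C])).
Proof.
rewrite /Imp; congr (Min (ubound _)); apply/seteqP; split=> l Ll.
  by move=> _ [b Bb [x Ux <-]]; apply: (Ll (b, x)).
by move=> [b x] [/= Bb Ux] _ ->; apply: Ll; exists b => //; exists x.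
Qed.

Lemma boxdot_top B : B \boxdot [set \top] = Max (lbound (ubound B)).
Proof.
rewrite /boxdot; congr (Max (lbound (ubound _))); apply/seteqP; split=> x.
  by move=> [b Bb [_ -> <-]]; rewrite rmul1.
by move=> Bx; exists x => //; exists \top; rewrite ?rmul1.
Qed.

Lemma top_Imp B : [set \top] \Imp B = Min (ubound B).
Proof.
(* Writing U(B) as ULU(B) gives both sides the same shape; it remains to match the implications from
   [\top] with U(B). *)
rewrite Imp_lbound -[in RHS]ubound_lbound_ubound.
congr (Min (ubound (lbound _))); apply/seteqP; split=> x.
  by move=> [_ -> [y Uy <-]]; rewrite top_imp.
by move=> Ux; exists \top => //; exists x; rewrite ?top_imp.
Qed.

Lemma boxdotC B C : B \boxdot C = C \boxdot B.
Proof.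
rewrite /boxdot; congr (Max (lbound (ubound _))).
by apply/seteqP; split=> _ [b Bb [c Cc <-]];
  exists c => //; exists b; rewrite // rmulC.
Qed.

Context (hA : MLUB_complete A).

Lemma boxdot_le_ubound B C D E :
  B \leS ubound C -> D \leS ubound E -> B \boxdot D \leS ubound (C \boxdot E).
Proof.
move=> le_BC le_DE x y [LUx _].
rewrite /boxdot ubound_Max_lbound_ubound // => /ubound_products Uy.
apply: LUx; apply/ubound_products => b e Bb De.
(* The factors are exchanged one at a time: [b \imp y] is shown to bound [E] above, then [e' \imp y]
   to bound [C] above. *)
rewrite rmulC; apply/radj; apply: le_DE => // e' Ee'.
apply/radj; rewrite rmulC; apply/radj; apply: le_BC => // c Cc.
by apply/radj; apply: Uy.
Qed.

(** Once [Max] and [Min] are removed, the two sides say [b \odot c <= x] and [b <= c \imp x] for all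
    [b] in [B], [c] in [C], [x] in U(D). *)
Lemma boxdot_adjoint B C D : B \boxdot C \leS ubound D <-> B \leS (C \Imp D).
Proof.
rewrite set_leEubound set_leElbound Imp_lbound lbound_Min_ubound_lbound //.
rewrite /boxdot ubound_Max_lbound_ubound //; split.
  move=> sDBC b Bb _ [c Cc [x Ux <-]]; apply/radj.
  by have /ubound_products := sDBC x Ux; apply.
move=> sB x Ux; apply/ubound_products => b c Bb Cc; apply/radj.
by apply: (sB b Bb); exists c => //; exists x.
Qed.

End ResiduatedSetsTheory.

Theorem theorem7p4 (d : Order.disp_t) (A : residuatedPOrderType d)
    (hA : MLUB_complete A) (B C D E : set A)
    (hB : B !=set0) (hC : C !=set0) (hD : D !=set0) (hE : E !=set0) :
  (B \boxdot [set \top] = Max (lbound (ubound B)) /\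
     [set \top] \Imp B = Min (ubound B)) /\
  (B \boxdot C = C \boxdot B) /\
  (B \leS ubound C -> D \leS ubound E ->
     B \boxdot D \leS ubound (C \boxdot E)) /\
  (B \boxdot C \leS ubound D <-> B \leS (C \Imp D)) /\
  (lbound (C \Imp D) \boxdot C \leS ubound D /\
     C \leS (lbound (C \Imp D) \Imp D)).
Proof.
have le_LImp : lbound (C \Imp D) \boxdot C \leS ubound D.
  (* By adjointness the claim becomes that L(C ⇒ D) lies below C ⇒ D. *)
  by apply/boxdot_adjoint => //; apply/set_leElbound.
split; first by split; [exact: boxdot_top | exact: top_Imp].
split; first exact: boxdotC.
split; first exact: boxdot_le_ubound.
split; first exact: boxdot_adjoint.
(* Adjointness turns the last claim into [le_LImp] with its two factors swapped. *)
split=> //; apply/boxdot_adjoint => //.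
by rewrite boxdotC.
Qed.
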